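(* Let $p$ be a prime with $p\equiv 3\pmod 4$, and let $S\subset\mathbb{F}_p^\times$ be the set of nonzero squares. Let $\mathcal{F}$ be the set of polynomials $f\in\mathbb{F}_p[x]$ with $f(a)^2=a$ for all $a\in S$. Then $$f(x)=x^{\frac{p+1}{4}}$$ computes square roots on $S$ (that is, $f\in\mathcal{F}$) and has minimal possible degree among polynomials in $\mathcal{F}$. If $p\ge 11$ (so that $\frac{p+1}{4}>2$), then $f$ is the unique polynomial of minimal degree in $\mathcal{F}$, up to sign.
   Context: $\mathbb{F}_p$ is the field with $p$ elements. ''Unique up to sign'' means that the polynomials of minimal degree in $\mathcal{F}$ are exactly $f$ and $-f$.
   Formalization: The claim that f has minimal degree is stated only for p ≠ 3: at p = 3 we have S = {1}, f(x) = x has degree 1, and the constant polynomial 1 lies in F with degree 0, so minimality fails there. *)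

(* Defs.v *)
From mathcomp Require Import all_boot all_order all_algebra.
Set Implicit Arguments.
Unset Strict Implicit.
Unset Printing Implicit Defensive.
Import GRing.Theory.
Local Open Scope ring_scope.

Definition nonzero_squares (p : nat) : {set 'F_p} :=
  [set a | (a != 0) && [exists b, a == b ^+ 2]].

Definition computes_sqrt (p : nat) (f : {poly 'F_p}) : Prop :=
  forall a, a \in nonzero_squares p -> f.[a] ^+ 2 = a.

(* Degrees are compared through [size], which is the degree plus one; the zero
   polynomial (size 0) never satisfies [computes_sqrt], since 1 is a nonzero
   square. *)
Definition has_min_degree (R : nzRingType) (F : {poly R} -> Prop)
    (f : {poly R}) : Prop :=
  F f /\ forall g, F g -> (size f <= size g)%N.

(* Main.v *)
Require Import Defs.
From mathcomp Require Import all_boot all_order all_algebra.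
From mathcomp Require Import finfield ring zify.
Set Implicit Arguments.
Unset Strict Implicit.
Unset Printing Implicit Defensive.
Import GRing.Theory.
Local Open Scope ring_scope.

(** Put [p = 4k + 3], [d = k + 1] and [n = 2k + 1], so that [S] is the zero set
    of [X^n - 1]. If [g] computes square roots on [S], then [X^n - 1] divides
    [g^2 - X], which is nonzero since [X] is not a square; hence [2 deg g >= n],
    and [deg g >= d] as [n] is odd. If [deg g = d], then
    [g^2 = X + u (X^n - 1) = l + u X^n] with [u] and [l = X - u] of degree at
    most one. So modulo [X^n] the polynomial [g] is a square root of [l]. It
    therefore solves the differential equation [2 l g' = l' g] of such a square
    root modulo [X^(n-1)] when [g(0) != 0], hence exactly when [d <= n - 2];
    comparing leading coefficients shows that this is impossible. Thus
    [g(0) = 0], which forces [l = 0] and [g^2 = X^(n+1)]. *)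

Lemma sqr_eq_linear_modXn (R : fieldType) (d n : nat) (g l u : {poly R}) :
    size g = d.+1 -> (d.+2 <= n)%N -> (size l <= 2)%N ->
    (d.*2)%:R != 0 :> R -> (d.*2)%:R != 1 :> R ->
  g ^+ 2 = l + u * 'X^n -> l = 0.
Proof.
move=> sz_g; case: n => // n; rewrite ltnS => lt_dn sz_l d2_neq0 d2_neq1 def_g2.
have gd_neq0 : g`_d != 0.
  by rewrite -[d]/(d.+1.-1) -sz_g -lead_coefE lead_coef_eq0 -size_poly_eq0 sz_g.
have d_gt0 : (0 < d)%N by case: (d) d2_neq0 => //; rewrite eqxx.
have def_l : l = l`_1 *: 'X + (l`_0)%:P.
  apply/polyP=> i; rewrite coefD coefZ coefX coefC.
  case: i => [|[|i]] /=; rewrite ?mulr0 ?mulr1 ?add0r ?addr0 //.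
  by rewrite nth_default // (leq_trans sz_l).
have l0E : l`_0 = g`_0 ^+ 2.
  have: (g ^+ 2)`_0 = (l + u * 'X^(n.+1))`_0 by rewrite def_g2.
  by rewrite expr2 coef0M coefD coefMXn addr0 -expr2 => <-.
have [g0_eq0 | g0_neq0] := eqVneq g`_0 0.
  (* Here ['X] divides [g], so ['X^2] divides [g ^+ 2], whose two lowest coefficients are those of
     [l]. *)
  have: (g ^+ 2)`_1 = (l + u * 'X^(n.+1))`_1 by rewrite def_g2.
  rewrite expr2 coefM !big_ord_recl big_ord0 /= g0_eq0 coefD coefMXn.
  rewrite ltnS (leq_trans _ lt_dn) // mul0r mulr0 !addr0 => l1_eq0.
  by rewrite def_l -l1_eq0 l0E g0_eq0 expr0n scale0r addr0.
(* The defect of the differential equation: ['X^n] divides it, while its size is at most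
   [d.+1 <= n]. *)
set e := l * g^`() *+ 2 - l^`() * g.
have e_eq0 : e = 0.
  have dvd_e : 'X^n %| e.
    have cop : coprimep 'X^n g.
      apply: coprimep_expl; rewrite coprimep_sym -['X]subr0 -polyC0.
      by rewrite coprimep_XsubC rootE horner_coef0.
    rewrite -(Gauss_dvdpr _ cop); apply/dvdpP.
    (* Since [g * e] is [l * (g^2)' - l' * g^2], the terms [l * l'] cancel once [g ^+ 2] is
       replaced; differentiating ['X^(n.+1)] costs one power of ['X]. *)
    exists (l * (u^`() * 'X + u *+ n.+1) - l^`() * u * 'X).
    have /(congr1 (@deriv R)) := def_g2.
    rewrite expr2 !derivE /= => def_dg2.
    have -> : g * e = l * (g^`() * g + g * g^`()) - l^`() * (g ^+ 2).
      by rewrite /e; ring.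
    rewrite def_dg2 def_g2 exprS -mulr_natr; ring.
  apply/eqP; apply: contraLR dvd_e => e_neq0.
  apply: contraFN (ltnn n) => /(dvdp_leq e_neq0); rewrite size_polyXn.
  move/leq_trans; apply; apply: leq_trans lt_dn.
  have szg' : (size g^`() <= d)%N.
    by rewrite -ltnS -sz_g lt_size_deriv // -size_poly_eq0 sz_g.
  rewrite (leq_trans (size_polyD _ _)) // size_polyN geq_max.
  have sz_l' : (size l^`() <= 1)%N.
    by rewrite (leq_trans (size_poly _ _)) // -subn1 leq_subLR.
  rewrite mulr2n (leq_trans (size_polyD _ _)) ?geq_max ?andbb.
    rewrite (leq_trans (size_polyMleq _ _)) // -subn1 leq_subLR sz_g.
    exact: leq_add sz_l' (leqnn _).
  rewrite (leq_trans (size_polyMleq _ _)) // -subn1 leq_subLR.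
  exact: leq_add sz_l szg'.
have l'E : l^`() = (l`_1)%:P.
  by rewrite {1}def_l derivD derivZ derivX derivC addr0 alg_polyC.
have l1_eq0 : l`_1 = 0.
  (* The top coefficient of [e] is [l_1 * g_d * (2d - 1)]. *)
  have: e`_d = 0 by rewrite e_eq0 coef0.
  rewrite /e l'E {1}def_l coefB coefMn mulrDl coefD -scalerAl coefZ !coefCM.
  rewrite coefXM -[d == 0]negbK -lt0n d_gt0 /= !coef_deriv prednK //.
  rewrite [g`_d.+1]nth_default ?sz_g // mul0rn mulr0 addr0 => /eqP.
  have -> : l`_1 * (g`_d *+ d) *+ 2 - l`_1 * g`_d
      = l`_1 * (g`_d * ((d.*2)%:R - 1)).
    rewrite -mul2n natrM -[_ *+ d]mulr_natr -[_ *+ 2]mulr_natr; ring.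
  by rewrite !mulf_eq0 subr_eq0 (negPf gd_neq0) (negPf d2_neq1) !orbF => /eqP.
(* With [l] now constant, the next coefficient is [2d * l_0 * g_d]. *)
have: e`_d.-1 = 0 by rewrite e_eq0 coef0.
rewrite /e l'E {1}def_l l1_eq0 scale0r add0r mul0r subr0 coefMn coefCM.
rewrite coef_deriv prednK // -mulrnAr -mulrnA muln2 -mulr_natr => /eqP.
rewrite !mulf_eq0 (negPf gd_neq0) (negPf d2_neq0) !orbF => /eqP l0_eq0.
by rewrite def_l l1_eq0 l0_eq0 scale0r add0r.
Qed.

(** Otherwise [r \Po 'X^2], of degree at most [2n - 2], would have all [p - 1 = 2n] nonzero elements
    as roots. *)
Lemma poly_eq0_on_squares (p n : nat) (r : {poly 'F_p}) :
    prime p -> p = n.*2.+1 -> (size r <= n)%N ->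
  (forall b, b != 0 -> r.[b ^+ 2] = 0) -> r = 0.
Proof.
move=> p_pr def_p sz_r r_sq0.
suff: r \Po 'X^2 == 0.
  move/eqP=> /polyP rX2_eq0; apply/polyP=> i; have:= rX2_eq0 (i * 2)%N.
  by rewrite coef_comp_poly_Xn // dvdn_mull // mulnK // !coef0.
apply: contraT => rX2_neq0.
have card_nz : #|[pred b : 'F_p | b != 0]| = n.*2.
  by rewrite cardC1 card_Fp // [in LHS]def_p.
have:= max_poly_roots (rs := enum [pred b : 'F_p | b != 0]) rX2_neq0.
rewrite enum_uniq -cardE card_nz => /(_ _ isT) sz_rX2.
have: (n.*2 < size (r \Po 'X^2))%N.
  apply: sz_rX2; apply/allP=> b; rewrite mem_enum inE => b_neq0.
  by rewrite rootE horner_comp hornerXn r_sq0.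
have r_neq0 : r != 0 by apply: contraNneq rX2_neq0 => ->; rewrite comp_poly0.
have:= size_comp_poly r 'X^2; rewrite size_polyXn /=.
move: r_neq0 sz_r; rewrite -size_poly_gt0.
by move: (size r) (size (r \Po 'X^2)) => sr srX2; lia.
Qed.

(** The degree of a nonzero square is even. *)
Lemma sqr_neq_polyX (R : idomainType) (g : {poly R}) : g ^+ 2 != 'X.
Proof.
apply/eqP=> /(congr1 (fun h : {poly R} => size h)).
have [-> | g_neq0] := eqVneq g 0; first by rewrite expr0n size_poly0 size_polyX.
rewrite size_polyX expr2 size_mul //.
by move: g_neq0; rewrite -size_poly_gt0; lia.
Qed.

Section SquareRootPolynomials.

Variables (p k : nat).
Hypotheses (p_pr : prime p) (def_p : p = (4 * k + 3)%N).

Lemma sqr_in_nonzero_squares (b : 'F_p) :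
  b != 0 -> b ^+ 2 \in nonzero_squares p.
Proof.
by move=> b_neq0; rewrite inE sqrf_eq0 b_neq0; apply/existsP; exists b.
Qed.

Lemma expf_Fp_predp (b : 'F_p) : b != 0 -> b ^+ p.-1 = 1.
Proof.
move=> b_neq0; apply: (mulfI b_neq0).
rewrite -exprS prednK ?prime_gt0 // mulr1.
by have := expf_card b; rewrite card_Fp.
Qed.

Lemma computes_sqrt_polyXn : computes_sqrt ('X^(k.+1) : {poly 'F_p}).
Proof.
move=> a; rewrite inE => /andP[a_neq0 /existsP[b /eqP def_a]].
have b_neq0 : b != 0 by apply: contraNneq a_neq0 => b0; rewrite def_a b0 expr0n.
rewrite hornerXn def_a -!exprM.
have -> : (2 * (k.+1 * 2) = p.-1 + 2)%N by lia.
by rewrite exprD expf_Fp_predp // mul1r.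
Qed.

(** Both polynomials vanish at nonzero squares, the divisor by Fermat as [2(2k + 1) = p - 1]; so
    does the remainder, which is too short to be nonzero. *)
Lemma computes_sqrt_dvdp (g : {poly 'F_p}) :
  computes_sqrt g -> 'X^(k.*2.+1) - 1 %| g ^+ 2 - 'X.
Proof.
move=> g_sqrt; apply/eqP; set q := g ^+ 2 - 'X; set m := 'X^_ - 1.
have sz_m : size m = k.*2.+2 by rewrite size_XnsubC.
apply: (poly_eq0_on_squares (n := k.*2.+1) p_pr); first by lia.
  by rewrite -ltnS -sz_m ltn_modp -size_poly_eq0 sz_m.
move=> b b_neq0; have: q.[b ^+ 2] = 0.
  rewrite hornerD hornerN hornerX horner_exp g_sqrt ?subrr //.
  exact: sqr_in_nonzero_squares.
rewrite {1}(divp_eq q m) hornerD hornerM.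
suff ->: m.[b ^+ 2] = 0 by rewrite mulr0 add0r.
rewrite hornerD hornerXn hornerN hornerC -exprM.
have -> : (2 * k.*2.+1 = p.-1)%N by lia.
by rewrite expf_Fp_predp // subrr.
Qed.

Lemma computes_sqrt_size (g : {poly 'F_p}) :
  (0 < k)%N -> computes_sqrt g -> (k.+2 <= size g)%N.
Proof.
move=> k_gt0 /computes_sqrt_dvdp /dvdp_leq; rewrite subr_eq0 sqr_neq_polyX.
rewrite size_XnsubC // => /(_ isT) /leq_trans /(_ (size_polyD _ _)).
(* The degree of ['X^(k.*2.+1) - 1] is bounded by that of [g ^+ 2] or of ['X]; [0 < k] excludes the
   latter. For [p = 3] the constant 1 already computes square roots. *)
rewrite size_polyN size_polyX leq_max => /orP[|]; last by lia.
move/leq_trans/(_ (size_polyMleq _ _)).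
by move: (size g) => s; lia.
Qed.

Lemma natr_Fp_neq0 (m : nat) : (0 < m < p)%N -> m%:R != 0 :> 'F_p.
Proof.
move=> /andP[m_gt0 lt_mp]; rewrite -(dvdn_pcharf (pchar_Fp p_pr)).
by rewrite gtnNdvd.
Qed.

Lemma computes_sqrt_size_eq (g : {poly 'F_p}) :
    (1 < k)%N -> computes_sqrt g -> size g = k.+2 ->
  g = 'X^(k.+1) \/ g = - 'X^(k.+1).
Proof.
move=> k_gt1 g_sqrt sz_g; have /dvdpP[u def_q] := computes_sqrt_dvdp g_sqrt.
have def_g2 : g ^+ 2 = ('X - u) + u * 'X^(k.*2.+1).
  by rewrite -[LHS](subrK 'X) def_q; ring.
have u_neq0 : u != 0.
  apply: contra_neq (sqr_neq_polyX g) => u0; apply/eqP.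
  by rewrite -subr_eq0 def_q u0 mul0r.
have sz_u : (size u <= 2)%N.
  have m_neq0 : 'X^(k.*2.+1) - 1 != 0 :> {poly 'F_p}.
    by rewrite -size_poly_eq0 size_XnsubC.
  have: (size (g ^+ 2 - 'X)%R <= k.*2.+3)%N.
    rewrite (leq_trans (size_polyD _ _)) // size_polyN size_polyX geq_max.
    by rewrite (leq_trans (size_polyMleq _ _)) // sz_g; lia.
  by rewrite def_q size_mul // size_XnsubC //; move: (size u) => su; lia.
have l_eq0 : 'X - u = 0.
  (* The condition [d + 2 <= n] reads [k + 3 <= 2k + 1], that is, [1 < k]; [2d = 2k + 2] and
     [2d - 1 = 2k + 1] lie strictly between 0 and [p]. *)
  apply: sqr_eq_linear_modXn sz_g _ _ _ _ def_g2; first by lia.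
  - by rewrite (leq_trans (size_polyD _ _)) // size_polyN size_polyX geq_max.
  - by apply: natr_Fp_neq0; lia.
  have -> : k.+1.*2 = k.*2.+1.+1 by lia.
  rewrite -natr1 -subr_eq0 addrK.
  by apply: natr_Fp_neq0; lia.
have /eqP : g ^+ 2 = ('X^(k.+1)) ^+ 2.
  rewrite def_g2 l_eq0 add0r -(subr0_eq l_eq0) -exprS -exprM.
  by congr ('X^_); lia.
by rewrite eqf_sqr => /orP[] /eqP; [left | right].
Qed.

End SquareRootPolynomials.

Theorem corollary3p1 (p : nat) (p_prime : prime p) (p_mod4 : p = 3 %[mod 4]) :
  let f : {poly 'F_p} := 'X^((p + 1) %/ 4) in
  [/\ computes_sqrt f,
      p <> 3%N -> has_min_degree (@computes_sqrt p) f
    & (11 <= p)%N -> forall g : {poly 'F_p},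
        has_min_degree (@computes_sqrt p) g <-> g = f \/ g = - f].
Proof.
have def_p : p = (4 * (p %/ 4) + 3)%N by lia.
move: (p %/ 4)%N def_p => k def_p f.
have def_f : f = 'X^(k.+1) by rewrite /f; congr ('X^_); lia.
have f_sqrt : computes_sqrt f by rewrite def_f; exact: computes_sqrt_polyXn.
have sz_f : size f = k.+2 by rewrite def_f size_polyXn.
have f_min : p <> 3%N -> has_min_degree (@computes_sqrt p) f.
  move=> p_neq3; split=> // g g_sqrt; rewrite sz_f.
  by apply: (computes_sqrt_size p_prime def_p) => //; lia.
split=> // p_ge11 g; have [_ f_le] : has_min_degree (@computes_sqrt p) f.
  by apply: f_min; lia.
split=> [[g_sqrt g_le] | [] ->]; last 2 first.
- by apply: f_min; lia.
- split=> [a Sa | h h_sqrt]; first by rewrite hornerN sqrrN f_sqrt.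
  by rewrite size_polyN f_le.
rewrite def_f; apply: (computes_sqrt_size_eq p_prime def_p) => //; first by lia.
by apply/eqP; rewrite -sz_f eqn_leq g_le ?f_le.
Qed.
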